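(* Let $\{A,B\}$ be an adjoint pair on a Hilbert space $\mathcal{H}$ such that $0$ is a regular point for $A$ and $B$. Suppose that $B$ is a closed formally normal operator and $\mathcal{D}(A)=\mathcal{D}(B)$. Let $R$ be the associated operator described in the context. Let $C$ be a densely defined closed linear operator from the Hilbert space $\mathcal{N}(B^* )$ into the Hilbert space $\mathcal{N}(A^* )$, and let $\mathcal{C}$ be the closed subspace $$\mathcal{C}=\{(Cv_1,v_1):\ v_1\in\mathcal{D}(C)\}$$ of $\mathcal{K}=\mathcal{N}(A^* )\oplus\mathcal{N}(B^* )$. Then the operator $T_{\mathcal{C}}$ is normal if and only if there exists an isometric linear operator $U$ of $\mathcal{D}(C^* )$ onto $\mathcal{D}(C)$ such that $$R^{-1}u_2+C^*u_2=(R^* )^{-1}Uu_2+CUu_2\quad\text{for all } u_2\in\mathcal{D}(C^* ).$$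
   Context: $\mathcal{D}(T)$ and $\mathcal{N}(T)$ denote the domain and the kernel of an operator $T$; $\dot{+}$ is the direct sum of vector spaces; $T\lceil\mathcal{D}$ is the restriction of $T$ to $\mathcal{D}$. The adjoint $C^*$ is an operator from $\mathcal{N}(A^* )$ into $\mathcal{N}(B^* )$. An adjoint pair $\{A,B\}$ is a pair of densely defined linear operators on $\mathcal{H}$ with $\langle Ax,y\rangle=\langle x,By\rangle$ for $x\in\mathcal{D}(A)$, $y\in\mathcal{D}(B)$. The number $0$ is a regular point for $T$ if there is $\gamma>0$ with $\|T\varphi\|\ge\gamma\|\varphi\|$ for all $\varphi\in\mathcal{D}(T)$. A densely defined operator $T$ is formally normal if $\mathcal{D}(T)\subseteq\mathcal{D}(T^* )$ and $\|Tx\|=\|T^*x\|$ for $x\in\mathcal{D}(T)$; it is normal if in addition $\mathcal{D}(T)=\mathcal{D}(T^* )$. Associated operator $R$: a fixed closed operator $R$ on $\mathcal{H}$ such that $R$ and $R^*$ have bounded everywhere defined inverses, $A\subseteq R\subseteq B^*$, $B\subseteq R^*\subseteq A^*$ (it exists by a theorem of Vishik); it satisfies $$\mathcal{D}(A^* )=\mathcal{D}(B)\dot{+}(R^* )^{-1}\mathcal{N}(B^* )\dot{+}\mathcal{N}(A^* ),\qquad \mathcal{D}(B^* )=\mathcal{D}(A)\dot{+}R^{-1}\mathcal{N}(A^* )\dot{+}\mathcal{N}(B^* ).$$ For a closed subspace $\mathcal{C}$ of $\mathcal{K}$ set $T_{\mathcal{C}}=A^*\lceil\mathcal{D}(T_{\mathcal{C}})$,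 where $$\mathcal{D}(T_{\mathcal{C}})=\{x_0+(R^* )^{-1}v_1+u_1:\ x_0\in\mathcal{D}(B),\ (u_1,v_1)\in\mathcal{C}\}.$$ *)

(* Defs.v *)
From HB Require Import structures.
From mathcomp Require Import all_boot all_order all_algebra.
From mathcomp Require Import all_classical all_reals all_analysis.
From mathcomp Require Import complex.

Set Implicit Arguments.
Unset Strict Implicit.
Unset Printing Implicit Defensive.
Import Order.TTheory GRing.Theory Num.Theory.
Import numFieldNormedType.Exports.

Local Open Scope classical_set_scope.
Local Open Scope ring_scope.

(* The values of [fn] outside [dom] are junk: every notion below only looks at
   an operator on its domain. *)
Record op (H : Type) := Op { dom : set H ; fn :> H -> H }.

Section Operators.
Variables (K : realType) (H : completeNormedModType K[i]).
Implicit Types (S T : op H) (M N D : set H).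

Definition linear_op T : Prop :=
  dom T 0 /\
  forall (a : K[i]) (x y : H), dom T x -> dom T y ->
    dom T (a *: x + y) /\ T (a *: x + y) = a *: T x + T y.

Definition graph T : set (H * H) := [set p | dom T p.1 /\ T p.1 = p.2].

(* Also used for an operator between closed subspaces of H, whose graph is
   closed in their product iff it is closed in H * H. *)
Definition closed_op T : Prop := closed (graph T).

Definition ker T : set H := [set x | dom T x /\ T x = 0].

Definition sub_op S T : Prop :=
  dom S `<=` dom T /\ forall x, dom S x -> S x = T x.

(* Meant for D `<=` dom T. *)
Definition restrict T D : op H := Op D T.

Definition inv_op T : op H :=
  Op (T @` dom T) (fun y => xget 0 [set x | dom T x /\ T x = y]).

Definition has_bounded_inverse T : Prop :=
  [/\ set_inj (dom T) T,
      dom (inv_op T) = setT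
    & exists c : K[i], forall y, `|inv_op T y| <= c * `|y| ].

Definition zero_regular T : Prop :=
  exists2 g : K[i], 0 < g & forall x, dom T x -> g * `|x| <= `|T x|.

(* T is a densely defined linear operator from the Hilbert space M into the
   Hilbert space N, both closed subspaces of H. *)
Definition dense_op_between M N T : Prop :=
  [/\ linear_op T, dom T `<=` M, M `<=` closure (dom T)
    & forall x, dom T x -> N (T x)].

Definition dense_op T : Prop := linear_op T /\ dense (dom T).

(* A form {dot _ for _} is linear in its first argument and conjugate linear in
   the second one. A complete normed space whose norm is given by such a form is
   a complex Hilbert space. *)
Variable dot : {dot H for @Num.conj K[i]}.

Definition hilbert_dot : Prop := forall x : H, `|x| ^+ 2 = dot x x.

(* The adjoint of an operator T from M into N is an operator from N into M. The
   vector w is unique as soon as dom T is dense in M. *)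
Definition adjoint_between M N T : op H :=
  let adj y w := M w /\ forall x, dom T x -> dot (T x) y = dot x w in
  Op [set y | N y /\ exists w, adj y w] (fun y => xget 0 [set w | adj y w]).

Definition adjoint T : op H := adjoint_between setT setT T.

Definition adjoint_pair S T : Prop :=
  [/\ dense_op S, dense_op T
    & forall x y, dom S x -> dom T y -> dot (S x) y = dot x (T y)].

Definition formally_normal T : Prop :=
  [/\ dense_op T, dom T `<=` dom (adjoint T)
    & forall x, dom T x -> `|T x| = `|adjoint T x| ].

Definition normal_op T : Prop :=
  formally_normal T /\ dom T = dom (adjoint T).

Definition associated_op (A B R : op H) : Prop :=
  [/\ linear_op R, closed_op R,
      has_bounded_inverse R /\ has_bounded_inverse (adjoint R),
      sub_op A R /\ sub_op R (adjoint B)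
    & sub_op B (adjoint R) /\ sub_op (adjoint R) (adjoint A)].

(* The pairs (u, v) of E are meant to lie in ker (adjoint A) `*` ker (adjoint B),
   which embeds isometrically in H * H. *)
Definition extension (A B R : op H) (E : set (H * H)) : op H :=
  restrict (adjoint A)
    [set x | exists x0 u v, [/\ dom B x0, E (u, v)
                              & x = x0 + inv_op (adjoint R) v + u]].

Definition flipped_graph (C : op H) : set (H * H) :=
  [set (C v, v) | v in dom C].

Definition isometry_onto D D' (U : op H) : Prop :=
  [/\ linear_op U, dom U = D, (forall x, D x -> `|U x| = `|x|)
    & U @` D = D'].

End Operators.

(* Main.v *)
Require Import Defs.
From HB Require Import structures.
From mathcomp Require Import all_boot all_order all_algebra.
From mathcomp Require Import all_classical all_reals all_analysis.
From mathcomp Require Import complex.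
From mathcomp Require Import ring lra.
Import Order.TTheory GRing.Theory Num.Theory.
Import numFieldNormedType.Exports.
Set Implicit Arguments.
Unset Strict Implicit.
Unset Printing Implicit Defensive.
Local Open Scope classical_set_scope.
Local Open Scope ring_scope.

(** Write I for the inverse of R, J for the inverse of R^*, C^* for the adjoint
of C, and T for the extension attached to the flipped graph of C; T acts by
T (x0 + J v + C v) = B x0 + v, for x0 in dom B and v in dom C.

The adjoint of T has the mirror description: its domain consists of the vectors
y0 + I u + C^* u with y0 in dom A and u in dom C^*, and
T^* (y0 + I u + C^* u) = A y0 + u. That these vectors lie in dom T^* is a
computation with inner products (adjoint_extensionP). Conversely
(dom_adjoint_extension), T extends B, so T^* y = B^* y =: w for y in dom T^*.
Since B is formally normal, A x and B x = T x have the same norm on the common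
domain (A is the restriction of B^* to it), so A inherits closedness from B; as
0 is a regular point for A, its range is closed and the projection theorem
splits w = A y0 + u with u in ker A^*. The remainder y - y0 - I u is killed by
B^*, and testing the definition of T^* against the vectors J v + C v says
exactly that it is C^* u.

In both descriptions the two terms of the image are orthogonal: ran B is
orthogonal to ker B^*, which contains v, and ran A to ker A^*, which contains u.
Let U be an isometry of dom C^* onto dom C with
I u + C^* u = J (U u) + C (U u). As dom A = dom B, the two domains coincide, and
for x = x0 + J (U u) + C (U u)
  |T x|^2 = |B x0|^2 + |U u|^2 = |A x0|^2 + |u|^2 = |T^* x|^2.

Suppose now that T is normal, and let x0 + J v + C v = I u + C^* u. Comparing
the norms of T and T^* at this vector gives |B x0|^2 + |v|^2 = |u|^2, and at the
vector minus x0 it gives |v|^2 = |A x0|^2 + |u|^2. Hence B x0 = 0, x0 = 0 and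
|u| = |v| (normal_extension_base0). As dom T = dom T^*, each u in dom C^* has
thus a partner v in dom C with I u + C^* u = J v + C v, and each v has such a
u. Since v is the image of that vector under A^*, the isometry is
U u = A^* (I u + C^* u), whose linearity is clear. *)

(** * Orthogonal projection in a complex Hilbert space *)

Section InnerProduct.
Variables (K : realType) (H : completeNormedModType K[i]).
Variable dot : {dot H for @Num.conj K[i]}.
Hypothesis dotH : hilbert_dot dot.
Implicit Types (x y z : H) (V : set H).

Lemma dotC x y : dot x y = Num.conj (dot y x).
Proof. by rewrite hermC expr0 mul1r. Qed.

Lemma dotDl x y z : dot (x + y) z = dot x z + dot y z.
Proof. exact: linearDl. Qed.

Lemma dotDr x y z : dot z (x + y) = dot z x + dot z y.
Proof. exact: linearDr. Qed.

Lemma dotBl x y z : dot (x - y) z = dot x z - dot y z.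
Proof. exact: linearBl. Qed.

Lemma dotBr x y z : dot z (x - y) = dot z x - dot z y.
Proof. exact: linearBr. Qed.

Lemma dotZl a x z : dot (a *: x) z = a * dot x z.
Proof. exact: linearZl_LR. Qed.

Lemma dotZr a x z : dot z (a *: x) = Num.conj a * dot z x.
Proof. exact: linearZr_LR. Qed.

Lemma dot0r z : dot z 0 = 0.
Proof. exact: linear0r. Qed.

Lemma dot_eq0C x y : dot x y = 0 -> dot y x = 0.
Proof. by rewrite (dotC y x) => ->; rewrite rmorph0. Qed.

Lemma pythagoras x y : dot x y = 0 -> `|x + y| ^+ 2 = `|x| ^+ 2 + `|y| ^+ 2.
Proof.
move=> xy0; rewrite !dotH dotDl !dotDr.
by rewrite xy0 (dot_eq0C xy0) addr0 add0r.
Qed.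

Lemma parallelogram x y :
  `|x + y| ^+ 2 + `|x - y| ^+ 2 = 2 * (`|x| ^+ 2 + `|y| ^+ 2).
Proof.
rewrite !dotH !(dotBl, dotBr, dotDl, dotDr); ring.
Qed.

Definition linear_set V :=
  V 0 /\ forall (a : K[i]) x y, V x -> V y -> V (a *: x + y).

Lemma linear_setD V x y : linear_set V -> V x -> V y -> V (x + y).
Proof. by move=> [_ VD] Vx Vy; rewrite -[x]scale1r; apply: VD. Qed.

Lemma linear_setN V x : linear_set V -> V x -> V (- x).
Proof.
by move=> [V0 VD] Vx; rewrite -scaleN1r -[_ *: _]addr0; apply: VD.
Qed.

Lemma linear_setB V x y : linear_set V -> V x -> V y -> V (x - y).
Proof. by move=> VL Vx Vy; apply: linear_setD => //; apply: linear_setN. Qed.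

Lemma linear_setZ V a x : linear_set V -> V x -> V (a *: x).
Proof. by move=> [V0 VD] Vx; rewrite -[_ *: _]addr0; apply: VD. Qed.

(** By Pythagoras every element of V is at distance at least |y| from y, whereas
y is a limit of such elements. *)
Lemma orthogonal_closure0 V y :
  closure V y -> (forall x, V x -> dot x y = 0) -> y = 0.
Proof.
move=> cVy Vy0; apply/eqP/negPn/negP => y_neq0.
have ny : 0 < `|y| by rewrite normr_gt0.
have [x [Vx]] := cVy _ (nbhsx_ballx y `|y| ny).
rewrite -ball_normE /= => yx.
have : `|x - y| ^+ 2 = `|x| ^+ 2 + `|y| ^+ 2.
  rewrite -(normrN y); apply: pythagoras.
  by rewrite -sub0r dotBr dot0r Vy0 ?subr0.
move=> e; have : `|x - y| ^+ 2 < `|y| ^+ 2.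
  by rewrite ltr_pXn2r ?nnegrE ?normr_ge0 // distrC.
by rewrite e gtrDr => /lt_geF; rewrite exprn_ge0.
Qed.

Lemma gt0_ReE (e : K[i]) : 0 < e -> (complex.Re e)%:C%C = e.
Proof. by move=> e0; rewrite RRe_real // ger0_real // ltW. Qed.

(** The norm of H takes its values in K[i], where the order is only partial;
its real part lives in K, where nonempty bounded sets have infima. *)
Definition rnorm x : K := complex.Re `|x|.

Lemma rnormE x : `|x| = (rnorm x)%:C%C.
Proof. by rewrite RRe_real ?normr_real. Qed.

Lemma rnorm_ge0 x : 0 <= rnorm x.
Proof. by rewrite -lecR -rnormE normr_ge0. Qed.

Lemma ler_rnormD x y : rnorm (x + y) <= rnorm x + rnorm y.
Proof. by rewrite -lecR rmorphD /= -!rnormE ler_normD. Qed.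

Lemma rnormN x : rnorm (- x) = rnorm x.
Proof. by rewrite /rnorm normrN. Qed.

Lemma rnorm_parallelogram x y :
  rnorm (x + y) ^+ 2 + rnorm (x - y) ^+ 2 = 2 * (rnorm x ^+ 2 + rnorm y ^+ 2).
Proof.
apply/eqP; rewrite -(inj_eq (@complexI K)); apply/eqP.
rewrite rmorphD [RHS]rmorphM [X in _ = _ * X]rmorphD !rmorphXn rmorph_nat /=.
rewrite -!rnormE.
exact: parallelogram.
Qed.

Lemma rnorm_double x : rnorm (x + x) = 2 * rnorm x.
Proof.
apply/eqP; rewrite -(inj_eq (@complexI K)); apply/eqP.
by rewrite rmorphM rmorph_nat /= -!rnormE -mulr2n normrMn mulr_natl.
Qed.

Lemma rnorm_cvgP (u : nat -> H) (l : H) :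
  (forall e : K, 0 < e -> \forall n \near \oo, rnorm (l - u n) < e) <->
  u @ \oo --> l.
Proof.
split=> [ul|/cvgrPdist_lt ul e e0]; last first.
  near=> n; rewrite -ltcR -rnormE; near: n; apply: ul; by rewrite ltcR.
apply/cvgrPdist_lt => e e0.
have eR := gt0_ReE e0.
near=> n; rewrite rnormE -eR ltcR; near: n; apply: ul.
by rewrite -ltcR eR.
Unshelve. all: by end_near. Qed.

Definition rcauchy (u : nat -> H) := forall e : K, 0 < e ->
  exists N : nat, forall m n, (N <= m)%N -> (N <= n)%N ->
    rnorm (u m - u n) < e.

Lemma rcauchy_cvg (u : nat -> H) : rcauchy u ->
  exists l : H, u @ \oo --> l.
Proof.
move=> uC; exists (lim (u @ \oo)).
apply: cauchy_cvg; apply: cauchy_exP => e e0.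
have eR := gt0_ReE e0.
have [|N uN] := uC (complex.Re e); first by rewrite -ltcR eR.
exists (u N); rewrite -ball_normE /=; exists N => //= n Nn.
by rewrite /preimage /ball_ /= rnormE -eR ltcR; apply: uN.
Qed.

Lemma cvg_rcauchy (u : nat -> H) (l : H) : u @ \oo --> l -> rcauchy u.
Proof.
move=> /rnorm_cvgP ul e e0; have e2 : 0 < e / 2 by lra.
have [N _ HN] := ul _ e2; exists N => m n /HN /= lm /HN /= ln.
have -> : u m - u n = - (l - u m) + (l - u n) by rewrite opprB addrA subrK.
have := ler_rnormD (- (l - u m)) (l - u n); rewrite rnormN; lra.
Qed.

(** Moving p along c v does not bring it closer to w. With r = w - p and
a = dot r v, the choice c = a / (|v|^2 + 1) changes |r - c v|^2 by a negative
multiple of |a|^2, which forces a = 0. Adding 1 to the denominator covers the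
case v = 0. *)
Lemma minimizer_orthogonal V w p : linear_set V -> V p ->
  (forall v, V v -> rnorm (w - p) <= rnorm (w - v)) ->
  forall v, V v -> dot v (w - p) = 0.
Proof.
move=> VL Vp min v Vv; apply: dot_eq0C.
set r := w - p; set a := dot r v.
have rmin (c : K[i]) : dot r r <= dot (r - c *: v) (r - c *: v).
  rewrite -!dotH ler_pXn2r ?nnegrE ?normr_ge0 // !rnormE lecR.
  have -> : r - c *: v = w - (c *: v + p) by rewrite opprD addrA addrAC.
  by apply: min; apply: VL.2.
clearbody r.
set q := dot v v.
have q0 : 0 <= q by rewrite /q -dotH exprn_ge0.
have q1 : 0 < q + 1 by rewrite ltr_wpDl.
have := rmin (a / (q + 1)).
rewrite dotBl !dotBr !dotZl !dotZr -/a -/q.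
have -> : dot v r = Num.conj a by rewrite -dotC.
rewrite rmorphM /= fmorphV (rmorphD _ q) /= rmorph1 (CrealP (ger0_real q0)).
set b := Num.conj a.
have -> : dot r r - b / (q + 1) * a - (a / (q + 1) * b - 
      a / (q + 1) * (b / (q + 1) * q)) =
   dot r r - (a * b) * ((q + 2) / (q + 1) ^+ 2).
  by field; rewrite gt_eqF.
rewrite -subr_ge0 addrAC subrr add0r oppr_ge0 pmulr_lle0; last first.
  by rewrite divr_gt0 ?exprn_gt0 // ltr_wpDl.
rewrite /b -normCK => ab; apply/eqP; rewrite -normr_eq0 -sqrf_eq0.
by rewrite eq_le ab exprn_ge0.
Qed.

Definition seq_closed V := forall (u : nat -> H) (l : H),
  (forall n, V (u n)) -> u @ \oo --> l -> V l.

(** A sequence in V whose distances to w tend to their infimum d is Cauchy: the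
midpoint of two of its terms lies in V, hence at distance at least d from w, so
the parallelogram law bounds the difference of the two terms. Its limit is a
point of V closest to w. *)
Lemma orthogonal_projection V w : linear_set V -> seq_closed V ->
  exists2 p, V p & forall v, V v -> dot v (w - p) = 0.
Proof.
move=> VL Vcl.
pose S := [set rnorm (w - v) | v in V].
have S0 : S !=set0 by exists (rnorm (w - 0)); exists 0 => //; apply: VL.1.
have Slb : has_lbound S by exists 0 => _ [v _ <-]; apply: rnorm_ge0.
pose d := inf S.
have dle v : V v -> d <= rnorm (w - v) by move=> Vv; apply: ge_inf => //; exists v.
have d0 : 0 <= d by apply: lb_le_inf => // _ [v _ <-]; apply: rnorm_ge0.
have /choice[u uP] (n : nat) : exists v, V v /\ rnorm (w - v) < d + n.+1%:R^-1.
  have [|_ [v Vv <-] vd] := @inf_adherent _ S n.+1%:R^-1 _ (conj S0 Slb).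
    by rewrite invr_gt0 ltr0n.
  by exists v.
have near_inv (e : K) : 0 < e ->
    exists N : nat, forall n, (N <= n)%N -> n.+1%:R^-1 < e.
  move=> e0; have [N _ HN] := near_infty_natSinv_lt (PosNum e0).
  by exists N => n /HN.
have [|p up] := @rcauchy_cvg u.
  move=> e e0.
  have c0 : 0 < 8 * d + 4 :> K by lra.
  (* The parallelogram law gives |u m - u n|^2 <= 4 (d + t)^2 - 4 d^2
     <= (8 d + 4) t as soon as both distances are below d + t with t <= 1. *)
  have [|N HN] := near_inv (Num.min 1 (e ^+ 2 / (8 * d + 4))).
    by rewrite lt_min ltr01 divr_gt0 ?exprn_gt0.
  exists N => m n Nm Nn.
  have := HN _ (leqnn N); rewrite lt_min => /andP[].
  rewrite ltr_pdivlMr //; set t := _^-1 => t1 te.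
  have t0 : 0 < t by rewrite invr_gt0 ltr0n.
  have le_t k : (N <= k)%N -> rnorm (w - u k) < d + t.
    move=> Nk; apply: (lt_le_trans (uP k).2); rewrite lerD2l /t.
    by rewrite lef_pV2 ?posrE ?ltr0n // ler_nat ltnS.
  have := rnorm_parallelogram (w - u m) (w - u n).
  have -> : w - u m - (w - u n) = - (u m - u n).
    by rewrite !opprB addrC addrA subrK.
  rewrite rnormN.
  have -> : w - u m + (w - u n) =
      (w - 2^-1 *: (u m + u n)) + (w - 2^-1 *: (u m + u n)).
    rewrite [RHS]addrACA [LHS]addrACA; congr (_ + _).
    rewrite -!opprD -scalerDl; congr (- _).
    have -> : 2^-1 + 2^-1 = 1 :> K[i] by field.
    by rewrite scale1r.
  rewrite rnorm_double.
  have := dle (2^-1 *: (u m + u n)) _.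
  move=> /(_ (linear_setZ _ VL (linear_setD VL (uP m).1 (uP n).1))).
  set z := rnorm (w - _ *: _).
  have := le_t _ Nm; have := le_t _ Nn.
  have := rnorm_ge0 (w - u m); have := rnorm_ge0 (w - u n).
  have := rnorm_ge0 (u m - u n).
  move: (rnorm (u m - u n)) (rnorm (w - u m)) (rnorm (w - u n)) => x a b.
  move=> x0 b0 a0 bd ad dz xE.
  rewrite -(@ltr_pXn2r _ 2) ?nnegrE //; last exact: ltW.
  have a2 : a ^+ 2 < (d + t) ^+ 2 by rewrite ltr_pXn2r ?nnegrE //; lra.
  have b2 : b ^+ 2 < (d + t) ^+ 2 by rewrite ltr_pXn2r ?nnegrE //; lra.
  have z2 : d ^+ 2 <= z ^+ 2 by rewrite ler_pXn2r ?nnegrE //; lra.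
  have t2 : t ^+ 2 <= t by rewrite expr2 ler_piMl // ltW.
  nra.
have Vp : V p by apply: (Vcl u) => // n; exact: (uP n).1.
exists p => //; apply: minimizer_orthogonal => // v Vv.
apply: (@le_trans _ _ d); last exact: dle.
suff le_de (e : K) : 0 < e -> rnorm (w - p) <= d + e by exact/ler_addgt0Pr.
move=> e0.
have e2 : 0 < e / 2 by lra.
have /rnorm_cvgP/(_ _ e2)[M _ HM] := up.
have [N HN] := near_inv _ e2.
have /= {}HM := HM (maxn M N) (leq_maxl _ _).
have {}HN := HN (maxn M N) (leq_maxr _ _).
have := (uP (maxn M N)).2.
have -> : w - p = (w - u (maxn M N)) + - (p - u (maxn M N)).
  by rewrite opprB addrA subrK.
have := ler_rnormD (w - u (maxn M N)) (- (p - u (maxn M N))).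
rewrite rnormN; move: HM HN.
move: ((maxn M N).+1%:R^-1 : K) (rnorm _) (rnorm (w - u _))
  (rnorm (_ - (p - _))) => t a b c.
lra.
Qed.

End InnerProduct.

(** * Linear operators: inverses, closedness and ranges *)

Section LinearOperators.
Variables (K : realType) (H : completeNormedModType K[i]).
Implicit Types (x y z : H) (S T : op H).

Lemma linear_op_dom T : linear_op T -> linear_set (dom T).
Proof. by move=> [T0 TD]; split=> // a x y Tx Ty; case: (TD a x y Tx Ty). Qed.

Lemma linear_opP T a x y : linear_op T -> dom T x -> dom T y ->
  T (a *: x + y) = a *: T x + T y.
Proof. by move=> [_ TD] Tx Ty; case: (TD a x y Tx Ty). Qed.

Lemma linear_opD T x y : linear_op T -> dom T x -> dom T y ->
  T (x + y) = T x + T y.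
Proof. by move=> TL Tx Ty; rewrite -[x]scale1r linear_opP // !scale1r. Qed.

Lemma linear_opB T x y : linear_op T -> dom T x -> dom T y ->
  T (x - y) = T x - T y.
Proof.
by move=> TL Tx Ty; rewrite addrC -scaleN1r linear_opP // scaleN1r addrC.
Qed.

Lemma linear_op0 T : linear_op T -> T 0 = 0.
Proof.
by move=> TL; have := linear_opB TL TL.1 TL.1; rewrite !subrr.
Qed.

Lemma linear_opN T x : linear_op T -> dom T x -> T (- x) = - T x.
Proof.
by move=> TL Tx; rewrite -sub0r linear_opB ?linear_op0 ?sub0r //; case: TL.
Qed.

Lemma ker_linear_set T : linear_op T -> linear_set (ker T).
Proof.
move=> TL; split=> [|a x y [Tx x0] [Ty y0]].
  by split; [case: TL | exact: linear_op0].
by split; [apply: (linear_op_dom TL).2 | rewrite linear_opP // x0 y0 scaler0 addr0].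
Qed.

Lemma range_linear_set T : linear_op T -> linear_set (T @` dom T).
Proof.
move=> TL; split=> [|a _ _ [x Tx <-] [y Ty <-]].
  by exists 0; [case: TL | exact: linear_op0].
by exists (a *: x + y); [apply: (linear_op_dom TL).2 | exact: linear_opP].
Qed.

Lemma inv_opP T y : has_bounded_inverse T ->
  dom T (inv_op T y) /\ T (inv_op T y) = y.
Proof.
move=> [_ Tsurj _]; have : dom (inv_op T) y by rewrite Tsurj.
by move=> [x Tx Txy]; apply: (@xgetPex _ 0 [set x | dom T x /\ T x = y]); exists x.
Qed.

Lemma inv_opK T x : has_bounded_inverse T -> dom T x -> inv_op T (T x) = x.
Proof.
move=> Tinv Tx; have [Ty TyE] := inv_opP (T x) Tinv.
by case: Tinv => Tinj _ _; apply: Tinj => //; apply/mem_set.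
Qed.

Lemma inv_op_linear T a x y : linear_op T -> has_bounded_inverse T ->
  inv_op T (a *: x + y) = a *: inv_op T x + inv_op T y.
Proof.
move=> TL Tinv; have [Tx xE] := inv_opP x Tinv; have [Ty yE] := inv_opP y Tinv.
rewrite -{1}xE -{1}yE -linear_opP // inv_opK //.
exact: (linear_op_dom TL).2.
Qed.

(** The form of closedness that passes between two operators whose values have
equal norms. *)
Definition seq_closed_op T := forall (x : nat -> H) (l m : H),
  (forall n, dom T (x n)) -> x @ \oo --> l -> T \o x @ \oo --> m ->
  dom T l /\ T l = m.

Lemma closed_op_seq T : closed_op T -> seq_closed_op T.
Proof.
move=> Tcl x l m Tx xl Txm.
have Txg : \forall n \near \oo, graph T (x n, T (x n)).
  by exists 0%N => //= n _; rewrite /graph /=; split.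
have Txlm : (x n, T (x n)) @[n --> \oo] --> (l, m) by exact: cvg_pair.
exact: (closed_cvg (graph T) Tcl Txg (l, m) Txlm).
Qed.

(** Both operators send the same sequences to Cauchy sequences. *)
Lemma seq_closed_op_eq_norm S T : linear_op S -> linear_op T -> dom S = dom T ->
  (forall x, dom T x -> `|S x| = `|T x|) -> seq_closed_op T -> seq_closed_op S.
Proof.
move=> SL TL domE STnorm Tcl x l m; rewrite domE => Tx xl Sxm.
have SEB y z : dom T y -> dom T z -> rnorm (S y - S z) = rnorm (T y - T z).
  move=> Ty Tz; rewrite -!linear_opB ?domE // /rnorm STnorm //.
  exact: linear_setB (linear_op_dom TL) _ _.
have [p Txp] : exists p : H, T \o x @ \oo --> p.
  apply: rcauchy_cvg => e e0; have [N HN] := cvg_rcauchy Sxm e0.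
  by exists N => i j Ni Nj /=; rewrite -SEB //; apply: HN.
have [Tl Tlp] := Tcl _ _ _ Tx xl Txp; split=> //.
apply: (cvg_unique _ _ Sxm); first exact: norm_hausdorff.
apply/rnorm_cvgP => e e0; move/rnorm_cvgP: Txp => /(_ e e0).
by apply: filterS => n /=; rewrite SEB // Tlp.
Qed.

Lemma zero_regular_rnorm T : zero_regular T ->
  exists2 g : K, 0 < g & forall x, dom T x -> g * rnorm x <= rnorm (T x).
Proof.
move=> [g g0 gT].
have gR := gt0_ReE g0.
exists (complex.Re g) => [|x Tx]; first by rewrite -ltcR gR.
by rewrite -lecR rmorphM /= -!rnormE gR gT.
Qed.

Lemma zero_regular_inj T x : zero_regular T -> dom T x -> T x = 0 -> x = 0.
Proof.
move=> /zero_regular_rnorm[g g0 gT] Tx Tx0; have := gT _ Tx.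
rewrite Tx0 {2}/rnorm normr0 pmulr_rle0 // => x0.
apply/eqP; rewrite -normr_eq0 rnormE; apply/eqP; congr (_%:C)%C.
by apply/eqP; rewrite eq_le x0 rnorm_ge0.
Qed.

(** Regularity makes preimages of a Cauchy sequence Cauchy. *)
Lemma range_seq_closed T : linear_op T -> seq_closed_op T -> zero_regular T ->
  seq_closed (T @` dom T).
Proof.
move=> TL Tcl /zero_regular_rnorm[g g0 gT] u l Tu ul.
have /choice[x xP] (n : nat) : exists x, dom T x /\ T x = u n.
  by have [x] := Tu n; exists x.
have Tx n : dom T (x n) by case: (xP n).
have Txu n : T (x n) = u n by case: (xP n).
have [|a xa] := @rcauchy_cvg _ _ x.
  move=> e e0; have [|N HN] := cvg_rcauchy ul (e := g * e).
    by rewrite mulr_gt0.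
  exists N => m n Nm Nn; have := HN _ _ Nm Nn.
  rewrite -!Txu -linear_opB // => lt_ge; rewrite -(ltr_pM2l g0).
  apply: le_lt_trans lt_ge; apply: gT.
  exact: linear_setB (linear_op_dom TL) _ _.
have [|Ta <-] := Tcl _ _ l Tx xa; last by exists a.
by rewrite (_ : T \o x = u) //; apply/funext.
Qed.

End LinearOperators.

(** * Adjoints *)

Section Adjoint.
Variables (K : realType) (H : completeNormedModType K[i]).
Variable dot : {dot H for @Num.conj K[i]}.
Hypothesis dotH : hilbert_dot dot.
Implicit Types (x y z w : H) (M N D : set H) (S T : op H).

Lemma dense_closure D : dense D -> setT `<=` closure D.
Proof.
move=> Dd x _ B; rewrite nbhsE => -[U [Uopen Ux] UB].
have [y [Uy Dy]] := Dd U (ex_intro _ x Ux) Uopen.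
by exists y; split=> //; apply: UB.
Qed.

Lemma adjoint_between_elim M N T y : dom (adjoint_between dot M N T) y ->
  [/\ N y, M (adjoint_between dot M N T y)
    & forall x, dom T x -> dot (T x) y = dot x (adjoint_between dot M N T y)].
Proof.
move=> [Ny [w [Mw wE]]].
have [Mz zE] := @xgetPex _ 0 [set w | M w /\
  forall x, dom T x -> dot (T x) y = dot x w] (ex_intro _ w (conj Mw wE)).
by split.
Qed.

(** Density of the domain makes the value of the adjoint unique, so that any w
satisfying the adjunction identity is the chosen one. *)
Lemma adjoint_between_intro M N T y w : linear_set M -> M `<=` closure (dom T) ->
  N y -> M w -> (forall x, dom T x -> dot (T x) y = dot x w) ->
  dom (adjoint_between dot M N T) y /\ adjoint_between dot M N T y = w.
Proof.
move=> ML Tdense Ny Mw wE.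
have Ty : dom (adjoint_between dot M N T) y by split=> //; exists w.
split=> //; have [_ Mz zE] := adjoint_between_elim Ty.
apply/eqP; rewrite -subr_eq0; apply/eqP.
apply: (@orthogonal_closure0 _ _ _ dotH (dom T)) => [|x Tx].
  by apply: Tdense; apply: linear_setB.
by rewrite dotBr -zE // -wE // subrr.
Qed.

Lemma adjoint_between_linear M N T :
  linear_set M -> linear_set N -> M `<=` closure (dom T) ->
  linear_op (adjoint_between dot M N T).
Proof.
move=> ML NL Tdense; split=> [|a x y /adjoint_between_elim[Nx Mx xE]].
  split; first exact: NL.1.
  by exists 0; split; [exact: ML.1 | move=> x _; rewrite !dot0r].
move=> /adjoint_between_elim[Ny My yE].
apply: adjoint_between_intro => //; [exact: NL.2 | exact: ML.2 | ].
by move=> z Tz; rewrite !dotDr !dotZr xE // yE.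
Qed.

Lemma adjoint_elim T x y : dom (adjoint dot T) y -> dom T x ->
  dot (T x) y = dot x (adjoint dot T y).
Proof. by move=> /adjoint_between_elim[_ _]; apply. Qed.

Lemma adjoint_intro T y w : dense_op T ->
  (forall x, dom T x -> dot (T x) y = dot x w) ->
  dom (adjoint dot T) y /\ adjoint dot T y = w.
Proof.
move=> [_ Td]; apply: adjoint_between_intro => //.
exact: dense_closure.
Qed.

Lemma adjoint_linear T : dense_op T -> linear_op (adjoint dot T).
Proof.
by move=> [_ Td]; apply: adjoint_between_linear => //; exact: dense_closure.
Qed.

Lemma ker_adjointP T u : dense_op T ->
  ker (adjoint dot T) u <-> forall x, dom T x -> dot (T x) u = 0.
Proof.
move=> Td; split=> [[Tu Tu0] x Tx|Tu0].
  by rewrite adjoint_elim // Tu0 dot0r.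
by apply: adjoint_intro => // x Tx; rewrite dot0r Tu0.
Qed.

(** The orthogonal complement of ran T is ker T^*, and ran T is closed. *)
Lemma range_ker_adjoint_decomposition T w :
  dense_op T -> seq_closed_op T -> zero_regular T ->
  exists2 x, dom T x & ker (adjoint dot T) (w - T x).
Proof.
move=> Td Tcl T0; have TL := Td.1.
have [_ [x Tx <-] wx] := orthogonal_projection dotH w
  (range_linear_set TL) (range_seq_closed TL Tcl T0).
by exists x => //; apply/ker_adjointP => // y Ty; apply: wx; exists y.
Qed.

End Adjoint.

(** * The extension of B attached to C, and its adjoint *)

Section Extension.
Variables (K : realType) (H : completeNormedModType K[i]).
Variable dot : {dot H for @Num.conj K[i]}.
Variables A B R C : op H.
Hypothesis dotH : hilbert_dot dot.
Hypothesis pairAB : adjoint_pair dot A B.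
Hypothesis assocR : associated_op dot A B R.
Hypothesis denseC :
  dense_op_between (ker (adjoint dot B)) (ker (adjoint dot A)) C.

Let denseA : dense_op A. Proof. by case: pairAB. Qed.
Let denseB : dense_op B. Proof. by case: pairAB. Qed.
Let denseR : dense_op R.
Proof.
case: assocR => RL _ _ [[AR _] _] _; split=> // U Un Uo.
by have [x [Ux /AR Rx]] := denseA.2 U Un Uo; exists x.
Qed.
Let linAs : linear_op (adjoint dot A). Proof. exact: adjoint_linear. Qed.
Let linBs : linear_op (adjoint dot B). Proof. exact: adjoint_linear. Qed.
Let linRs : linear_op (adjoint dot R). Proof. exact: adjoint_linear. Qed.
Let invR : has_bounded_inverse R. Proof. by case: assocR => _ _ []. Qed.
Let invRs : has_bounded_inverse (adjoint dot R).
Proof. by case: assocR => _ _ []. Qed.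

Local Notation I := (inv_op R).
Local Notation J := (inv_op (adjoint dot R)).
Local Notation Cadj :=
  (adjoint_between dot (ker (adjoint dot B)) (ker (adjoint dot A)) C).
Local Notation T := (extension dot A B R (flipped_graph C)).

Lemma adjointB_A x : dom A x -> dom (adjoint dot B) x /\ adjoint dot B x = A x.
Proof.
move=> Ax; apply: adjoint_intro => // y By.
by case: pairAB => _ _ AB; rewrite dotC -AB // -dotC.
Qed.

Lemma adjointA_B x : dom B x -> dom (adjoint dot A) x /\ adjoint dot A x = B x.
Proof. by move=> Bx; apply: adjoint_intro => // y Ay; case: pairAB => _ _ ->. Qed.

Lemma inv_RA x : dom A x -> I (A x) = x.
Proof.
case: assocR => _ _ _ [[AR RA] _] _ Ax.
by rewrite RA // inv_opK //; apply: AR.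
Qed.

Lemma adjointB_inv_R w : dom (adjoint dot B) (I w) /\ adjoint dot B (I w) = w.
Proof.
case: assocR => _ _ _ [_ [RB RBE]] _; have [Rw wE] := inv_opP w invR.
by split; [exact: RB | rewrite -RBE].
Qed.

Lemma adjointA_inv_Rs w : dom (adjoint dot A) (J w) /\ adjoint dot A (J w) = w.
Proof.
case: assocR => _ _ _ _ [_ [RA RAE]]; have [Rw wE] := inv_opP w invRs.
by split; [exact: RA | rewrite -RAE].
Qed.

Lemma dot_inv_R v w : dot v (I w) = dot (J v) w.
Proof.
have [Rv vE] := inv_opP v invRs; have [Rw wE] := inv_opP w invR.
by rewrite -{1}vE dotC -adjoint_elim // wE -dotC.
Qed.

Lemma dom_extension x : dom T x ->
  exists x0 v, [/\ dom B x0, dom C v & x = x0 + J v + C v].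
Proof. by move=> [x0 [u [v [Bx0 [v' Cv' [<- <-]] ->]]]]; exists x0, v'. Qed.

Lemma extensionP x0 v : dom B x0 -> dom C v ->
  dom T (x0 + J v + C v) /\ T (x0 + J v + C v) = B x0 + v.
Proof.
move=> Bx0 Cv; split; first by exists x0, (C v), v; split=> //; exists v.
have [_ _ _ /(_ _ Cv)[Acv Acv0]] := denseC.
have [Ax0 x0E] := adjointA_B Bx0; have [Av vE] := adjointA_inv_Rs v.
rewrite -[LHS]/(adjoint dot A (x0 + J v + C v)).
rewrite !(linear_opD linAs) // ?Acv0 ?x0E ?vE ?addr0 //.
exact: linear_setD (linear_op_dom linAs) _ _.
Qed.

Lemma sub_extension x : dom B x -> dom T x /\ T x = B x.
Proof.
have [[C0 _] _ _ _] := denseC; have [CL _ _ _] := denseC.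
move=> Bx; have := extensionP Bx C0; rewrite (linear_op0 CL) !addr0.
suff -> : J 0 = 0 by rewrite addr0.
by rewrite -[X in J X](linear_op0 linRs) inv_opK //; case: linRs.
Qed.

Lemma extension_dense : dense_op T.
Proof.
split; last first.
  move=> U Un Uo; have [x [Ux /sub_extension[Tx _]]] := denseB.2 U Un Uo.
  by exists x.
have TA x : dom T x -> dom (adjoint dot A) x.
  move=> /dom_extension[x0 [v [Bx0 Cv ->]]].
  have [_ _ _ /(_ _ Cv)[Acv _]] := denseC.
  have [Ax0 _] := adjointA_B Bx0; have [Av _] := adjointA_inv_Rs v.
  by do 2?apply: linear_setD (linear_op_dom linAs) _ _.
split=> [|a x y Tx Ty]; first by case: (sub_extension denseB.1.1).
split; last by exact: (linear_opP a linAs (TA _ Tx) (TA _ Ty)).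
have [CL _ _ _] := denseC.
have [x0 [v [Bx Cv ->]]] := dom_extension Tx.
have [y0 [w [By Cw ->]]] := dom_extension Ty.
have /extensionP/(_ ((linear_op_dom CL).2 a _ _ Cv Cw))[] :=
  (linear_op_dom denseB.1).2 a _ _ Bx By.
rewrite inv_op_linear // (linear_opP a CL Cv Cw) => Txy _.
by rewrite !scalerDr addrACA [X in X + _]addrACA.
Qed.

Lemma Cadj_linear : linear_op Cadj.
Proof.
by apply: adjoint_between_linear => //; try exact: ker_linear_set; case: denseC.
Qed.

(** Expanding dot (T x) y and dot x (T^* y) for x = x0 + J v + C v and
y = y0 + I u + C^* u, the terms with a range against a kernel vanish, and the
others agree pairwise; the pair dot v (C^* u), dot (C v) u is the definition of
C^*. *)
Lemma adjoint_extensionP y0 u : dom A y0 -> dom Cadj u ->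
  dom (adjoint dot T) (y0 + I u + Cadj u) /\
  adjoint dot T (y0 + I u + Cadj u) = A y0 + u.
Proof.
move=> Ay0 Cu; have [Au BCu CuE] := adjoint_between_elim Cu.
apply: adjoint_intro => // [|x /dom_extension[x0 [v [Bx0 Cv ->]]]].
  exact: extension_dense.
have [_ _ _ /(_ _ Cv) ACv] := denseC.
have [_ CB _ _] := denseC; have Bv := CB _ Cv.
rewrite (extensionP Bx0 Cv).2 !(dotDl, dotDr).
have -> : dot (B x0) (Cadj u) = 0 by apply: ((ker_adjointP dotH _ denseB).1 BCu).
have -> : dot (C v) (A y0) = 0.
  by apply: dot_eq0C; apply: ((ker_adjointP dotH _ denseA).1 ACv).
have -> : dot (B x0) y0 = dot x0 (A y0).
  by rewrite adjoint_elim ?(adjointB_A Ay0).2 //; case: (adjointB_A Ay0).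
have -> : dot (B x0) (I u) = dot x0 u.
  have [BIu IuE] := adjointB_inv_R u.
  by rewrite adjoint_elim // IuE.
have -> : dot v y0 = dot (J v) (A y0) by rewrite -dot_inv_R inv_RA.
by rewrite dot_inv_R -CuE //; ring.
Qed.

Hypothesis closedA : seq_closed_op A.
Hypothesis regA : zero_regular A.

(** The component y0 comes from splitting T^* y = A y0 + u along
ran A + ker A^*; then y - (y0 + I u) lies in ker B^*, and the adjunction identity
of T on the vectors J v + C v identifies it as C^* u. *)
Lemma dom_adjoint_extension y : dom (adjoint dot T) y ->
  exists y0 u, [/\ dom A y0, dom Cadj u & y = y0 + I u + Cadj u].
Proof.
move=> Ty; set w := adjoint dot T y.
have [By Bw] : dom (adjoint dot B) y /\ adjoint dot B y = w.
  apply: adjoint_intro => // x Bx; have [Tx <-] := sub_extension Bx.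
  exact: adjoint_elim.
have [y0 Ay0 Au] :=
  range_ker_adjoint_decomposition dotH w denseA closedA regA.
set u := w - A y0 in Au.
have [By0 y0E] := adjointB_A Ay0; have [BIu IuE] := adjointB_inv_R u.
have By0u : dom (adjoint dot B) (y0 + I u).
  exact: linear_setD (linear_op_dom linBs) _ _.
pose z := y - (y0 + I u).
have Bz : ker (adjoint dot B) z.
  split; first exact: linear_setB (linear_op_dom linBs) _ _.
  by rewrite linear_opB // linear_opD // Bw y0E IuE [X in _ - X]addrC subrK subrr.
have [|||||Cu CuE] := @adjoint_between_intro _ _ _ dotH
  (ker (adjoint dot B)) (ker (adjoint dot A)) C u z.
- exact: ker_linear_set.
- by case: denseC.
- by [].
- by [].
- move=> v Cv.
  have [_ _ _ /(_ _ Cv) ACv] := denseC.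
  have [Tv vE] := extensionP denseB.1.1 Cv.
  have := adjoint_elim Ty Tv.
  rewrite vE (linear_op0 denseB.1) !add0r -/w => vyE.
  rewrite /z dotBr dotDr vyE dot_inv_R /u dotDl !dotBr.
  have -> : dot (C v) (A y0) = 0.
    by apply: dot_eq0C; apply: ((ker_adjointP dotH _ denseA).1 ACv).
  have -> : dot v y0 = dot (J v) (A y0) by rewrite -dot_inv_R inv_RA.
  by ring.
exists y0, u; split=> //.
by rewrite CuE addrC subrK.
Qed.

(** * Normality of the extension *)

Hypothesis domAB : dom A = dom B.
Hypothesis normAB : forall x, dom B x -> `|A x| = `|B x|.

(** The equality |T x| = |T^* x| is used at x = x0 + J v + C v and at x - x0;
by Pythagoras the two resulting identities add up to |B x0|^2 + |A x0|^2 = 0. *)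
Lemma normal_extension_base0 x0 v u : normal_op dot T ->
  dom B x0 -> dom C v -> dom Cadj u ->
  x0 + J v + C v = I u + Cadj u -> x0 = 0 /\ `|u| = `|v|.
Proof.
move=> [[_ _ Tnorm] _] Bx0 Cv Cu xE.
have B0 : dom B 0 by case: denseB.1.
have BN : dom B (- x0) by apply: linear_setN (linear_op_dom denseB.1) _.
have Ax0 : dom A x0 by rewrite domAB.
have Bv : ker (adjoint dot B) v by case: denseC => _ + _ _; apply.
have [Au _ _] := adjoint_between_elim Cu.
have norm1 : `|B x0| ^+ 2 + `|v| ^+ 2 = `|u| ^+ 2.
  have [Tx TxE] := extensionP Bx0 Cv; have := Tnorm _ Tx; rewrite TxE xE.
  have [_] : dom (adjoint dot T) (0 + I u + Cadj u) /\
      adjoint dot T (0 + I u + Cadj u) = A 0 + u.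
    by apply: adjoint_extensionP => //; rewrite domAB.
  rewrite (linear_op0 denseA.1) !add0r => -> <-.
  by rewrite (pythagoras dotH) //; exact: ((ker_adjointP dotH _ denseB).1 Bv).
have norm2 : `|v| ^+ 2 = `|A x0| ^+ 2 + `|u| ^+ 2.
  (* The vector minus x0 reads 0 + J v + C v for T and - x0 + I u + C^* u for
     T^*. *)
  have [Tx TxE] := extensionP B0 Cv; have := Tnorm _ Tx; rewrite TxE.
  have -> : 0 + J v + C v = - x0 + I u + Cadj u.
    by rewrite add0r -(addrA (- x0)) -xE -(addrA x0) addKr.
  have [||_ ->] := @adjoint_extensionP (- x0) u; [by rewrite domAB|by []|].
  rewrite (linear_op0 denseB.1) add0r (linear_opN denseA.1) // => ->.
  rewrite -(normrN (A x0)) (pythagoras dotH) // -(linear_opN denseA.1) //.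
  by apply: ((ker_adjointP dotH _ denseA).1 Au); rewrite domAB.
have Bx0_0 : `|B x0| = 0.
  have double0 (a b : K[i]) : b = a + (a + b) -> a = 0.
    rewrite addrA -{1}[b]add0r => /addIr/esym/eqP.
    by rewrite -mulr2n mulrn_eq0 => /eqP.
  by move: norm2; rewrite normAB // -norm1 => /double0/eqP; rewrite sqrf_eq0 => /eqP.
have x0_0 : x0 = 0.
  apply: zero_regular_inj regA _ _ => //.
  by apply/eqP; rewrite -normr_eq0 normAB // Bx0_0.
split=> //; apply/eqP; rewrite -(@eqrXn2 _ 2) // -norm1 Bx0_0 expr0n add0r //.
Qed.

(** The partner v of u is recovered by applying A^* to I u + C^* u = J v + C v,
since A^* (J v) = v and C v is in ker A^*. Defining U this way makes it visibly
linear and needs no choice of v. *)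
Definition intertwiner : op H :=
  Op (dom Cadj) (fun u => adjoint dot A (I u + Cadj u)).

Lemma intertwinerE u v : dom C v -> I u + Cadj u = J v + C v ->
  intertwiner u = v.
Proof.
move=> Cv uv; rewrite -[LHS]/(adjoint dot A (I u + Cadj u)) uv -[J v]add0r.
have [_ TE] := extensionP denseB.1.1 Cv.
by apply: etrans TE _; rewrite (linear_op0 denseB.1) add0r.
Qed.

Lemma normal_extension_intertwiner : normal_op dot T ->
  isometry_onto (dom Cadj) (dom C) intertwiner /\
  forall u, dom Cadj u ->
    I u + Cadj u = J (intertwiner u) + C (intertwiner u).
Proof.
move=> Tnormal; have domT := Tnormal.2.
have AI u : dom Cadj u -> dom (adjoint dot T) (I u + Cadj u).
  move=> Cu; have [] := adjoint_extensionP denseA.1.1 Cu.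
  by rewrite add0r.
have partner u : dom Cadj u ->
    exists v, [/\ dom C v, I u + Cadj u = J v + C v & `|u| = `|v| ].
  move=> Cu; have := AI _ Cu; rewrite -domT => /dom_extension[x0 [v [Bx0 Cv E]]].
  have [x00 uv] := normal_extension_base0 Tnormal Bx0 Cv Cu (esym E).
  by exists v; split=> //; rewrite E x00 add0r.
split; last first.
  by move=> u /partner[v [Cv uv _]]; rewrite (intertwinerE Cv uv).
split=> //.
- split=> [|a x y Cx Cy]; first by case: Cadj_linear.
  split; first exact: (linear_op_dom Cadj_linear).2.
  have TA x' : dom Cadj x' -> dom (adjoint dot A) (I x' + Cadj x').
    move=> /partner[v [Cv -> _]].
    have [_ _ _ /(_ _ Cv)[Acv _]] := denseC.
    apply: linear_setD (linear_op_dom linAs) _ Acv.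
    by case: (adjointA_inv_Rs v).
  have RL : linear_op R by case: denseR.
  have sumE : I (a *: x + y) + Cadj (a *: x + y) =
      a *: (I x + Cadj x) + (I y + Cadj y).
    rewrite (inv_op_linear _ _ _ RL invR) (linear_opP _ Cadj_linear) //.
    by rewrite scalerDr addrACA.
  rewrite -[LHS]/(adjoint dot A (I (a *: x + y) + Cadj (a *: x + y))) sumE.
  exact: (linear_opP a linAs (TA _ Cx) (TA _ Cy)).
- by move=> u /partner[v [Cv uv ->]]; rewrite (intertwinerE Cv uv).
- apply/seteqP; split=> [_ [u /partner[v [Cv uv _]] <-]|v Cv].
    by rewrite (intertwinerE Cv uv).
  have [Tv _] := extensionP denseB.1.1 Cv.
  have := Tv; rewrite domT => /dom_adjoint_extension[y0 [u [Ay0 Cu E]]].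
  (* Moving y0 to the other side brings the equation into the form treated by
     normal_extension_base0, with x0 = - y0. *)
  have BN : dom B (- y0).
    by apply: linear_setN (linear_op_dom denseB.1) _; rewrite -domAB.
  have [|y00 _] := normal_extension_base0 Tnormal BN Cv Cu.
    by move: E; rewrite add0r -!addrA => ->; rewrite addKr.
  exists u => //; apply: intertwinerE => //.
  by rewrite -[J v]add0r E -[y0]opprK y00 oppr0 add0r.
Qed.

(** Both domains consist of the vectors x0 + J (U u) + C (U u), and Pythagoras
splits |T x|^2 and |T^* x|^2 into equal pieces. *)
Lemma intertwined_extension_normal U :
  isometry_onto (dom Cadj) (dom C) U ->
  (forall u, dom Cadj u -> I u + Cadj u = J (U u) + C (U u)) ->
  normal_op dot T.
Proof.
move=> [_ _ Uiso Uonto] UE.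
have CU u : dom Cadj u -> dom C (U u) by rewrite -Uonto => Cu; exists u.
have sum_eq x0 u : dom Cadj u ->
    x0 + I u + Cadj u = x0 + J (U u) + C (U u).
  by move=> Cu; rewrite -!addrA UE.
have Text x : dom T x -> exists x0 u, [/\ dom B x0, dom Cadj u
    & x = x0 + J (U u) + C (U u)].
  move=> /dom_extension[x0 [v [Bx0]]]; rewrite -Uonto => -[u Cu <-] ->.
  by exists x0, u.
have subT : dom T `<=` dom (adjoint dot T).
  move=> x /Text[x0 [u [Bx0 Cu ->]]]; rewrite -sum_eq //.
  by case: (@adjoint_extensionP x0 u); rewrite ?domAB.
split; last first.
  apply/seteqP; split=> // x /dom_adjoint_extension[x0 [u [Ax0 Cu ->]]].
  rewrite sum_eq //; case: (@extensionP x0 (U u)) => //; last exact: CU.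
  by rewrite -domAB.
split=> //; first exact: extension_dense.
move=> x /Text[x0 [u [Bx0 Cu ->]]].
rewrite (extensionP Bx0 (CU _ Cu)).2 -sum_eq //.
have Ax0 : dom A x0 by rewrite domAB.
rewrite (adjoint_extensionP Ax0 Cu).2.
apply/eqP; rewrite -(@eqrXn2 _ 2) // !(pythagoras dotH) ?Uiso ?normAB //.
  have [Au _ _] := adjoint_between_elim Cu.
  exact: ((ker_adjointP dotH _ denseA).1 Au).
have Bv : ker (adjoint dot B) (U u).
  by case: denseC => _ + _ _; apply; exact: CU.
exact: ((ker_adjointP dotH _ denseB).1 Bv).
Qed.

End Extension.

Unset Implicit Arguments.

Theorem theorem12 (K : realType) (H : completeNormedModType K[i])
    (dot : {dot H for @Num.conj K[i]}) (A B R C : op H) :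
  hilbert_dot dot ->
  adjoint_pair dot A B ->
  zero_regular A -> zero_regular B ->
  closed_op B -> formally_normal dot B ->
  dom A = dom B ->
  associated_op dot A B R ->
  dense_op_between (ker (adjoint dot B)) (ker (adjoint dot A)) C ->
  closed_op C ->
  let Cadj :=
    adjoint_between dot (ker (adjoint dot B)) (ker (adjoint dot A)) C in
  normal_op dot (extension dot A B R (flipped_graph C)) <->
  exists U : op H,
    isometry_onto (dom Cadj) (dom C) U /\
    forall u2, dom Cadj u2 ->
      inv_op R u2 + Cadj u2 = inv_op (adjoint dot R) (U u2) + C (U u2).
Proof.
move=> dotH pairAB regA _ closedB [_ _ Bnorm] domAB assocR denseC _ Cadj.
have [[linA _] [linB _] _] := pairAB.
have normAB x : dom B x -> `|A x| = `|B x|.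
  by move=> Bx; rewrite Bnorm // (adjointB_A dotH pairAB _).2 // domAB.
have closedA : seq_closed_op A.
  exact: seq_closed_op_eq_norm linA linB domAB normAB (closed_op_seq closedB).
split=> [Tnormal|[U [Uiso UE]]]; last exact: intertwined_extension_normal UE.
exists (intertwiner dot A B R C).
exact: normal_extension_intertwiner.
Qed.
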